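(* Let $k\ge 2$. A $k$-uniform hypergraph $G$ is Berge if and only if it is $C_\omega$-perfect.
   Context: All hypergraphs are finite. A $k$-uniform hypergraph $G$ has a vertex set $V(G)$ and an edge set $E(G)$ consisting of $k$-element subsets of $V(G)$. For $W\subseteq V(G)$, $G[W]$ is the induced subhypergraph on $W$. A $k$-uniform hypergraph is complete if all $k$-subsets of its vertex set are edges (vacuously so if there are fewer than $k$ vertices), and $\omega(G)$ is the maximum size of $W\subseteq V(G)$ such that $G[W]$ is complete. For $X\subseteq V(G)$ with $|X|<k$, the link $lk_G(X)$ is the $(k-|X|)$-uniform hypergraph with vertex set $V(G)\setminus X$ in which $Y$ is an edge iff $X\cup Y\in E(G)$. A proper $s$-coloring of a $k$-uniform hypergraph $G$ is a coloring of the $(k-1)$-element subsets of $V(G)$ with $s$ colors such that for no edge $F$ of $G$ do all the $(k-1)$-subsets of $F$ receive the same color. For $X\subseteq V(G)$ with $|X|<k-1$, a coloring $c$ of the $(k-1)$-subsets of $V(G)$ restricts to the coloring $Z\mapsto c(X\cup Z)$ of the $(k-1-|X|)$-subsets $Z$ of $V(G)\setminus X=V(lk_G(X))$. $G$ is $C_\omega$-perfect if for every induced subhypergraph $G'$ of $G$ and every $X\subseteq V(G')$ with $|X|<k-1$, there is a proper $(\omega(G')-k+2)$-coloring of $G'$ that restricts to a proper $(\omega(G')-k+2)$-coloring of $lk_{G'}(X)$. $G$ is Berge if for every induced subhypergraph $G'$ of $G$ and every $X\subseteq V(G')$ with $|X|=k-2$, there is a proper $(\omega(G')-k+2)$-coloring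 of $G'$ that restricts to a proper $(\omega(G')-k+2)$-coloring of $lk_{G'}(X)$. (In both definitions, if $|V(G')|<k-1$ there are no $(k-1)$-subsets to color and the condition is regarded as satisfied.) *)

(* Defs.v *)
From mathcomp Require Import all_boot.

Set Implicit Arguments.
Unset Strict Implicit.
Unset Printing Implicit Defensive.

(* The vertex set is a finite set inside an ambient finite type T, so that
   induced subhypergraphs and links are again hypergraphs over T. *)
Record hypergraph (T : finType) (k : nat) := Hypergraph {
  vset : {set T};
  eset : {set {set T}};
  eset_uniform : forall F : {set T}, F \in eset -> F \subset vset /\ #|F| = k
}.

Section Hypergraph.

Variables (T : finType) (k : nat).
Implicit Types (G : hypergraph T k) (W X : {set T}).

Lemma induced_uniform G W (F : {set T}) :
  F \in [set F in eset G | F \subset W] ->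
  F \subset vset G :&: W /\ #|F| = k.
Proof.
rewrite inE => /andP[/eset_uniform[FV Fk] FW].
by rewrite subsetI FV FW.
Qed.

(* G[W]; intersecting with W makes the operation total, and the vertex set is
   W itself when W \subset vset G. *)
Definition induced G W : hypergraph T k := Hypergraph (@induced_uniform G W).

Lemma link_uniform G X (Y : {set T}) :
  Y \in [set Y : {set T} | (Y \subset vset G :\: X) && (X :|: Y \in eset G)] ->
  Y \subset vset G :\: X /\ #|Y| = k - #|X|.
Proof.
rewrite inE => /andP[YV /eset_uniform[_ XYk]]; split=> //.
have XY0 : X :&: Y = set0.
  apply: disjoint_setI0; rewrite disjoint_sym.
  by move: YV; rewrite subsetD => /andP[].
by move: XYk; rewrite cardsU XY0 cards0 subn0 => <-; rewrite addKn.
Qed.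

Definition link G X : hypergraph T (k - #|X|) :=
  Hypergraph (@link_uniform G X).

Definition complete G : bool :=
  [forall F : {set T}, (F \subset vset G) && (#|F| == k) ==> (F \in eset G)].

Definition omega G : nat :=
  \max_(W : {set T} | (W \subset vset G) && complete (induced G W)) #|W|.

(* The colors are 0, ..., s - 1. A coloring is represented by a function on all
   sets; only its values on the (k-1)-subsets of the vertex set matter. *)
Definition coloring G (s : nat) (c : {set T} -> nat) : Prop :=
  forall S : {set T}, S \subset vset G -> #|S| = k.-1 -> c S < s.

Definition proper_coloring G (s : nat) (c : {set T} -> nat) : Prop :=
  coloring G s c /\
  forall F : {set T}, F \in eset G ->
    ~ exists a : nat,
        forall S : {set T}, S \subset F -> #|S| = k.-1 -> c S = a.

End Hypergraph.

Definition restrict_coloring (T : finType) (X : {set T}) (c : {set T} -> nat) :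
  {set T} -> nat := fun Z => c (X :|: Z).

(* The number of colors omega(G) - k + 2 is written omega G + 2 - k. The
   truncated subtraction is harmless: if G has at least k - 1 vertices then
   omega G >= k - 1; otherwise there are no (k-1)-subsets to color, there are
   no edges, and the property below holds for every c. *)
Definition link_colorable (T : finType) (k : nat) (G : hypergraph T k)
    (X : {set T}) : Prop :=
  exists c : {set T} -> nat,
    proper_coloring G (omega G + 2 - k) c /\
    proper_coloring (link G X) (omega G + 2 - k) (restrict_coloring X c).

Definition Comega_perfect (T : finType) (k : nat) (G : hypergraph T k) : Prop :=
  forall W : {set T}, W \subset vset G ->
  forall X : {set T}, X \subset vset (induced G W) -> #|X| < k.-1 ->
    link_colorable (induced G W) X.

Definition Berge (T : finType) (k : nat) (G : hypergraph T k) : Prop :=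
  forall W : {set T}, W \subset vset G ->
  forall X : {set T}, X \subset vset (induced G W) -> #|X| = k - 2 ->
    link_colorable (induced G W) X.

(* Main.v *)
Require Import Defs.
From mathcomp Require Import all_boot.

(** A C_omega-perfect hypergraph is Berge because k - 2 < k - 1.  Conversely,
    work inside one induced subhypergraph G.  The Berge condition gives, for
    each set P of k - 2 vertices, a coloring f_P that is proper on G and on the
    graph lk(P); these colorings are glued into a single coloring for a given X
    with |X| <= k - 2.  Fix a linear order of the vertices.  Every (k-1)-set S
    has a vertex outside X; let x be the first one, and give S the color
    f_P(S) where P = S - x.

    Let F be an edge, and let a, b be the first two vertices of F outside X;
    they exist because |X| <= k - 2.  Removing the first vertices outside X
    from F - a and F - b (b and a respectively) leaves the same set
    P = F - a - b, so both are colored by f_P, and since {a, b} is an edge of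
    lk(P), their colors differ ([peel_coloring_separates]).  Hence the coloring
    is proper on G.  Moreover F - a and F - b both contain X whenever F does, so
    the coloring is also proper on lk(X) ([link_colorable_smaller]). *)

Lemma cardsD1_pred {T : finType} (A : {set T}) (x : T) :
  x \in A -> #|A :\ x| = #|A|.-1.
Proof. by move=> xA; rewrite (cardsD1 x A) xA. Qed.

(** Removing either of the first two elements of A makes the other one first:
    the order on T given by [enum] is compatible with taking subsets. *)
Lemma enum_first_two {T : finType} (A : {set T}) :
  1 < #|A| ->
  exists a b, [/\ a \in A, b \in A, a != b,
    ohead (enum (A :\ a)) = Some b & ohead (enum (A :\ b)) = Some a].
Proof.
have enumD1 x : enum (A :\ x) = [seq y <- enum A | y != x].
  by rewrite /enum_mem -filter_predI; apply: eq_filter => y; rewrite !inE.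
rewrite cardE; case eA: (enum A) => [|a [|b s]] // _.
have := enum_uniq A; rewrite eA /= inE negb_or => /andP[/andP[ab _] _].
exists a, b; split=> //.
- by rewrite -mem_enum eA !inE eqxx.
- by rewrite -mem_enum eA !inE eqxx orbT.
- by rewrite enumD1 eA /= eqxx eq_sym ab.
- by rewrite enumD1 eA /= ab.
Qed.

(** The color of S is f_P(S), where P is S without its first vertex outside X.
    The default 0 is reached only when S is contained in X, which is impossible
    for a (k-1)-set S once |X| < k - 1. *)
Definition peel_coloring {T : finType} (X : {set T})
    (f : {set T} -> {set T} -> nat) (S : {set T}) : nat :=
  if ohead (enum (S :\: X)) is Some x then f (S :\ x) S else 0.

Section PeelColoring.

Variables (T : finType) (k : nat) (G : hypergraph T k) (s : nat).
Variables (X : {set T}) (f : {set T} -> {set T} -> nat).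
Hypothesis ltXk : #|X| < k.-1.
Hypothesis f_proper : forall P : {set T}, P \subset vset G -> #|P| = k - 2 ->
  proper_coloring G s (f P) /\
  proper_coloring (link G P) s (restrict_coloring P (f P)).

Let c := peel_coloring X f.

Lemma peel_coloring_lt : coloring G s c.
Proof.
move=> S SV Sk; rewrite /c /peel_coloring.
have: 0 < #|S :\: X|.
  by rewrite cardsD subn_gt0 Sk (leq_ltn_trans (subset_leq_card (subsetIr _ _))).
rewrite cardE; case eS: (enum _) => [|x r] //= _.
have /setDP[xS _]: x \in S :\: X by rewrite -mem_enum eS mem_head.
have [|| [cS _] _] := f_proper (S :\ x); last exact: cS.
- exact: subset_trans (subD1set S x) SV.
- by rewrite cardsD1_pred // Sk subn2.
Qed.

(** With a and b the first two vertices of F outside X, both colors are given by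
    f_P for P = F - a - b, and f_P is proper on the edge {a, b} of lk(P). *)
Lemma peel_coloring_separates (F : {set T}) : F \in eset G ->
  exists a b, [/\ a \in F :\: X, b \in F :\: X & c (F :\ a) <> c (F :\ b)].
Proof.
move=> FG; have [FV Fk] := eset_uniform FG.
have k1 : 1 < k by case: (k) ltXk => [|[|]].
have: 1 < #|F :\: X|.
  rewrite cardsD Fk ltn_subRL addn1 -(ltn_predK k1) ltnS.
  exact: leq_ltn_trans (subset_leq_card (subsetIr _ _)) ltXk.
case/enum_first_two=> a [b [aFX bFX ab hb ha]].
exists a, b; split=> //; rewrite /c /peel_coloring.
have D1D x : F :\ x :\: X = F :\: X :\ x by rewrite !setDDl setUC.
rewrite !D1D hb ha; set P := F :\ a :\ b.
have PbaE : F :\ b :\ a = P by rewrite /P !setDDl setUC.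
have /setDP[aF _] := aFX; have /setDP[bF _] := bFX.
have bFa : b \in F :\ a by rewrite !inE eq_sym ab.
have aFb : a \in F :\ b by rewrite !inE ab.
have FbE : F :\ b = P :|: [set a] by rewrite setUC -PbaE setD1K.
have FaE : F :\ a = P :|: [set b] by rewrite setUC setD1K.
have PF : P :|: [set a; b] = F.
  by rewrite [[set a; b]]setUC setUA -FaE setUC setD1K.
have Pk : #|P| = k - 2.
  by rewrite -Fk (cardsD1 a F) aF (cardsD1 b (F :\ a)) bFa addnA addKn.
have PV : P \subset vset G by rewrite (subset_trans _ FV) // -PF subsetUl.
have [_ [_ linkP]] := f_proper _ PV Pk.
have abP : [set a; b] \in eset (link G P).
  rewrite inE PF FG andbT; apply/subsetP=> y; rewrite !inE => /orP[] /eqP->.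
    by rewrite eqxx andbF (subsetP FV).
  by rewrite eqxx (subsetP FV).
rewrite PbaE FbE FaE => eq_ab; apply: (linkP _ abP).
(* The sets to compare are the singletons, since lk(P) is 2-uniform. *)
exists (f P (P :|: [set a])) => S Sab; rewrite Pk subKn //= => /eqP/cards1P[y Sy].
move: Sab; rewrite Sy sub1set !inE /restrict_coloring => /orP[] /eqP-> //.
Qed.

End PeelColoring.

(** An edge Y of lk(X) gives the edge F = X :|: Y of G; the vertices a and b that
    separate F lie in Y, so Y - a and Y - b get different restricted colors. *)
Lemma link_colorable_smaller (T : finType) (k : nat) (G : hypergraph T k)
    (X : {set T}) :
  (forall P : {set T}, P \subset vset G -> #|P| = k - 2 -> link_colorable G P) ->
  X \subset vset G -> #|X| < k.-1 -> link_colorable G X.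
Proof.
move=> colG XV ltXk; set s := omega G + 2 - k.
have /fin_all_exists[f f_proper] : forall P : {set T},
    exists c : {set T} -> nat, P \subset vset G -> #|P| = k - 2 ->
    proper_coloring G s c /\
    proper_coloring (link G P) s (restrict_coloring P c).
  move=> P.
  have [PV | nPV] := boolP (P \subset vset G); last by exists (fun=> 0).
  have [Pk | nPk] := eqVneq #|P| (k - 2); last first.
    by exists (fun=> 0) => _ /eqP; rewrite (negPf nPk).
  by have [c cP] := colG P PV Pk; exists c.
have c_lt := peel_coloring_lt _ _ _ _ _ _ ltXk f_proper.
have c_sep := peel_coloring_separates _ _ _ _ _ _ ltXk f_proper.
exists (peel_coloring X f); split; split=> //.
- move=> F FG [col mono]; have [a [b [/setDP[aF _] /setDP[bF _]]]] := c_sep F FG.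
  by case; rewrite !mono ?subD1set ?cardsD1_pred ?(eset_uniform FG).2.
- move=> Z; rewrite subsetD => /andP[ZV dZX] Zk; apply: c_lt.
    by rewrite subUset XV.
  rewrite cardsU disjoint_setI0 1?disjoint_sym // cards0 subn0 Zk.
  rewrite -subn1 subnAC subn1 subnKC //; exact: ltnW.
- move=> Y YL [col mono]; have [YVX Yk] := link_uniform YL.
  move: (YL); rewrite inE => /andP[_ FG].
  have [a [b [aFX bFX]]] := c_sep _ FG.
  have restrictD1 x : x \in (X :|: Y) :\: X ->
      peel_coloring X f ((X :|: Y) :\ x) = col.
    move=> /setDP[xF xX]; have xY : x \in Y by case/setUP: xF xX => [->|].
    rewrite -(mono (Y :\ x)) ?subD1set ?cardsD1_pred ?Yk //.
    congr peel_coloring; apply/setP=> y; rewrite !inE.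
    by have [-> | //] := eqVneq y x; rewrite (negPf xX).
  by case; rewrite !restrictD1.
Qed.

Theorem mainTheorem5 (T : finType) (k : nat) (hk : 2 <= k)
    (G : hypergraph T k) :
  Berge G <-> Comega_perfect G.
Proof.
split=> perfG W WV X XW cardX.
  by apply: link_colorable_smaller XW cardX => P; apply: perfG.
by apply: perfG => //; rewrite cardX -subn1 ltn_sub2l.
Qed.
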